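(* Let $\mathfrak g$ be a finite-dimensional complex simple Lie algebra with root system $R$ and simple roots $\Sigma$, let $\Theta\subset\Sigma$, and let $R_t$ be the set of t-roots of the associated flag manifold $\mathbb F_\Theta$. Then $R_t$ is connected by triples zero sum.
   Context: Notation. $\mathfrak h$ is a Cartan subalgebra of $\mathfrak g$, $B$ the Killing form, $R$ the root system of $(\mathfrak g,\mathfrak h)$, and $H_\alpha\in\mathfrak h$ is defined by $\alpha(X)=B(X,H_\alpha)$ for $X\in\mathfrak h$. $\mathfrak h_{\mathbb R}$ is the real span of $\{H_\alpha:\alpha\in R\}$. $R_\Theta=\langle\Theta\rangle\cap R$ is the set of roots in the span of $\Theta$, and $R_M=R\setminus R_\Theta$. Put $$\mathfrak t=\{H\in i\mathfrak h_{\mathbb R}:\alpha(H)=0\text{ for all }\alpha\in R_\Theta\},\qquad k(\alpha)=\alpha|_{\mathfrak t}.$$ The set of t-roots is $R_t=k(R_M)$. (The flag manifold is $\mathbb F_\Theta=G/P_\Theta$, where $G$ is a Lie group with Lie algebra $\mathfrak g$ and $P_\Theta$ is the parabolic subgroup determined by $\Theta$; only $R_t$ matters here.) Connectedness by triples zero sum. Let $\Gamma$ be a nonempty set of linear functionals. Two elements $\alpha,\beta\in\Gamma$ with $\alpha\ne\pm\beta$ are connected by triples zero sum (tzs) in $\Gamma$ if there is a finite chain of triples $T^1,\dots,T^n$, each of the form $T^p=\{\gamma_i,\gamma_j,\gamma_k\}\subset\Gamma$ with $\gamma_i+\gamma_j+\gamma_k=0$ (the entries of a triple need not be distinct), such that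 $\alpha$ or $-\alpha$ belongs to $T^1$, $\beta$ or $-\beta$ belongs to $T^n$, and $T^p\cap T^{p+1}\neq\emptyset$ for $1\le p\le n-1$. The set $\Gamma$ is connected by tzs if every pair $\alpha,\beta\in\Gamma$ with $\alpha\neq\pm\beta$ is connected by tzs in $\Gamma$. *)

(* Defs.v *)
From HB Require Import structures.
From mathcomp Require Import all_boot all_order all_algebra.
From mathcomp Require Import boolp classical_sets functions reals.
From mathcomp Require Import complex.

Set Implicit Arguments.
Unset Strict Implicit.
Unset Printing Implicit Defensive.

Import Order.TTheory GRing.Theory Num.Theory.
Local Open Scope classical_set_scope.
Local Open Scope ring_scope.

(** * Finite-dimensional Lie algebras *)

HB.mixin Record Vector_isLieAlgebra (K : fieldType) (g : Type)
    of Vector K g := {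
  lie : g -> g -> g;
  lie_linearl : forall y, linear (lie^~ y);
  lie_linearr : forall x, linear (lie x);
  liexx : forall x, lie x x = 0;
  lie_jacobi : forall x y z,
    lie x (lie y z) + lie y (lie z x) + lie z (lie x y) = 0
}.

#[short(type="lieAlgType")]
HB.structure Definition LieAlgebra (K : fieldType) :=
  { g of Vector_isLieAlgebra K g & Vector K g }.

Notation "[| x , y |]" := (lie x y)
  (at level 0, x, y at level 99, format "[| x ,  y |]") : ring_scope.

Section Lie.
Context {K : fieldType} {g : lieAlgType K}.
Implicit Types (x y : g) (a h I : {vspace g}).

HB.instance Definition _ x := GRing.isSemilinear.Build K g g *:%R (lie x)
  (GRing.semilinear_linear (lie_linearr x)).

Definition ad x : 'End(g) := linfun (lie x).

Lemma adE x y : ad x y = [| x, y |].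
Proof. exact: lfunE. Qed.

(* [passmx.mxof] acts on row vectors, so it reverses composition; the trace does not
   depend on this. *)
Definition lfun_trace (f : 'End(g)) : K :=
  \tr (passmx.mxof (vbasis fullv) (vbasis fullv) f).

Definition killing x y : K := lfun_trace (ad x \o ad y)%VF.

Definition lie_ideal I := forall x y, y \in I -> [| x, y |] \in I.

Definition lie_abelian a := forall x y, x \in a -> y \in a -> [| x, y |] = 0.

Definition semisimple_end (f : 'End(g)) :=
  forall U : {vspace g}, (f @: U <= U)%VS ->
  exists W : {vspace g},
    [/\ (f @: W <= W)%VS, (U + W = fullv)%VS & (U :&: W = 0)%VS].

(* Cartan subalgebras of a semisimple Lie algebra (in the sense of Helgason):
   maximal abelian subalgebras acting by semisimple endomorphisms.  An abelian
   subspace is automatically a subalgebra. *)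
Definition cartan_subalgebra h :=
  [/\ lie_abelian h,
      (forall a, lie_abelian a -> (h <= a)%VS -> a = h)
    & (forall x, x \in h -> semisimple_end (ad x))].

Definition is_root h (alpha : 'Hom(subvs_of h, K^o)) :=
  alpha <> 0 /\
  exists2 x : g, x <> 0 & forall H : subvs_of h, [| vsval H, x |] = (alpha H : K) *: x.

(* Linear independence is taken in the dual of [h]. *)
Definition simple_system h (S : seq 'Hom(subvs_of h, K^o)) :=
  [/\ (forall alpha, alpha \in S -> is_root alpha),
      free S
    & (forall alpha, is_root alpha ->
       exists c : 'I_(size S) -> nat,
         alpha = \sum_(i < size S) S`_i *+ c i \/
         alpha = - \sum_(i < size S) S`_i *+ c i)].

End Lie.

Definition simple_lie (K : fieldType) (g : lieAlgType K) :=
  ~ lie_abelian (fullv : {vspace g}) /\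
  forall I : {vspace g}, lie_ideal I -> I = 0%VS \/ I = fullv.

(** * Roots relative to a set [T] of simple roots *)

Section TRoots.
Context {R : realType} {g : lieAlgType R[i]} {h : {vspace g}}.
Notation dual := 'Hom(subvs_of h, R[i]^o).
Implicit Types (T : seq dual) (alpha : dual).

Definition R_in T : set dual :=
  [set alpha | is_root alpha /\ alpha \in <<T>>%VS].

Definition R_out T : set dual := [set alpha | is_root alpha] `\` R_in T.

(* [H] is the vector representing [alpha] with respect to the Killing form,
   which is nondegenerate on [h] when [g] is semisimple. *)
Definition represents alpha (H : subvs_of h) :=
  forall X : subvs_of h, alpha X = killing (vsval X) (vsval H).

Definition h_real : set (subvs_of h) :=
  [set H | exists n (a : 'I_n -> R) (v : 'I_n -> subvs_of h),
     (forall j, exists2 alpha, is_root alpha & represents alpha (v j)) /\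
     H = \sum_(j < n) (a j)%:C%C *: v j].

Definition ih_real : set (subvs_of h) := [set 'i%C *: H | H in h_real].

Definition t_space T : set (subvs_of h) :=
  [set H | ih_real H /\ forall alpha, R_in T alpha -> alpha H = 0].

Definition t_restr T alpha : t_space T -> R[i] := fun H => alpha (\val H).

Definition t_roots T : set (t_space T -> R[i]) :=
  [set @t_restr T alpha | alpha in R_out T].

End TRoots.

Arguments t_restr {R g h} T alpha _.
Arguments t_roots {R g h} T _.

(** * Connectedness by triples zero sum *)

Section TZS.
Context {V : zmodType}.
Implicit Types (G T : set V) (a b : V).

Definition zero_sum_triple G T :=
  exists x y z, [/\ G x, G y, G z, x + y + z = 0 & T = [set x; y; z]].

(* The chain is [T 0, ..., T n], so it has [n + 1 >= 1] triples. *)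
Definition tzs_linked G a b :=
  exists n (T : nat -> set V),
    [/\ forall p, (p <= n)%N -> zero_sum_triple G (T p),
        T 0%N a \/ T 0%N (- a),
        T n b \/ T n (- b)
      & forall p, (p < n)%N -> T p `&` T p.+1 !=set0].

Definition tzs_connected G :=
  forall a b, G a -> G b -> a <> b -> a <> - b -> tzs_linked G a b.

End TZS.

(* Main.v *)
(** The t-roots grade [g]: restricting to [t] the weights of a basis of [g] that
    diagonalizes [h] gives [ [g_x, g_y] \subset g_(x + y) ], where [x] and [y] are
    t-roots or zero.  Let [C] be a class of t-roots for the relation "equal up to
    sign or linked by zero sum triples", and let [Q] be the t-roots outside [C].
    If [x \in C] and [y \in Q], then [x + y] is neither zero nor a t-root, since
    otherwise [x, y, -(x + y)] would be a zero sum triple; hence [ [g_x, g_y] = 0 ].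
    It follows that the elements supported outside [Q] that commute with every
    [g_y], [y \in Q], form an ideal.  It contains [g_x] for [x \in C] and meets
    [g_y] trivially for [y \in Q], so simplicity forces [Q] to be empty.

    The triples require [R = -R].  If [-alpha] is not a root, then the root vectors
    of [alpha] lie in the radical of the Killing form, which is then all of [g].
    But an [H] in [h] at which every simple root takes the value 1 satisfies
    [B(H, H) > 0], because all weights are integers at [H]. *)

Require Import Defs.
From HB Require Import structures.
From mathcomp Require Import all_boot all_order all_algebra.
From mathcomp Require Import boolp classical_sets functions reals.
From mathcomp Require Import complex.

Set Implicit Arguments.
Unset Strict Implicit.
Unset Printing Implicit Defensive.

Import Order.TTheory GRing.Theory Num.Theory passmx.
Local Open Scope ring_scope.

(** * Bracket identities and traces of endomorphisms *)

Section LieBracket.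
Context {K : fieldType} {g : lieAlgType K}.
Implicit Types x y z : g.

Lemma lie0x x : [| 0, x |] = 0.
Proof.
have := lie_linearl x (-1) 0 0.
by rewrite /= scaler0 addr0 scaleN1r addNr.
Qed.

Lemma lieDl x y z : [| x + y, z |] = [| x, z |] + [| y, z |].
Proof. by have := lie_linearl z 1 x y; rewrite /= !scale1r. Qed.

Lemma lieZl a x z : [| a *: x, z |] = a *: [| x, z |].
Proof. by have := lie_linearl z a x 0; rewrite /= lie0x !addr0. Qed.

Lemma lie_suml I (r : seq I) P (F : I -> g) z :
  [| \sum_(i <- r | P i) F i, z |] = \sum_(i <- r | P i) [| F i, z |].
Proof.
by apply: (big_morph (fun x => [| x, z |])) => [x y | ]; rewrite ?lieDl ?lie0x.
Qed.

Lemma lieC x y : [| x, y |] = - [| y, x |].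
Proof.
apply/eqP; rewrite -addr_eq0; apply/eqP.
by have := liexx (x + y); rewrite lieDl !linearD /= !liexx add0r addr0.
Qed.

Lemma lie_jacobil x y z :
  [| x, [| y, z |] |] = [| [| x, y |], z |] + [| y, [| x, z |] |].
Proof.
have := lie_jacobi x y z; rewrite -addrA => /eqP; rewrite addr_eq0 => /eqP ->.
by rewrite opprD addrC (lieC z x) (lieC [|x, y|] z) linearN opprK.
Qed.

Lemma ad_comm x y : [| x, y |] = 0 -> (ad x \o ad y = ad y \o ad x)%VF.
Proof.
move=> xy0; apply/lfunP => z; rewrite !comp_lfunE !adE.
by rewrite lie_jacobil xy0 lie0x add0r.
Qed.

(** Inserting the identity as a change of basis and cycling the matrix trace replaces [vbasis] by
    [e]; Killing values can then be read off in a weight basis. *)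
Lemma lfun_traceE (e : (\dim {:g}).-tuple g) (f : 'End(g)) :
  basis_of fullv e -> lfun_trace f = \sum_i coord e i (f e`_i).
Proof.
move=> eb; have bb := vbasisP (fullv : {vspace g}).
rewrite /lfun_trace -[f in LHS]comp_lfun1r.
rewrite (mxof_comp _ _ eb) mxtrace_mulC -(mxof_comp _ _ bb).
rewrite comp_lfun1l /mxtrace; apply: eq_bigr => i _.
by rewrite !mxE /= vecof_delta.
Qed.

Lemma lfun_traceC (u v : 'End(g)) : lfun_trace (u \o v) = lfun_trace (v \o u).
Proof.
have bb := vbasisP (fullv : {vspace g}).
by rewrite /lfun_trace !(mxof_comp _ _ bb) mxtrace_mulC.
Qed.
End LieBracket.

(** * Simultaneous diagonalization of a Cartan subalgebra *)

(** The sum [S] of the eigenspaces is stable, so it has a stable complement [W]. A nonzero [W] would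
    contain an eigenvector, which already lies in [S]. *)
Lemma semisimple_end_diagonalizable (C : numClosedFieldType) (g : lieAlgType C)
    (f : 'End(g)) :
  semisimple_end f ->
  diagonalizable (mxof (vbasis fullv) (vbasis fullv) f).
Proof.
set b := vbasis fullv => fss.
have bb : basis_of fullv b := vbasisP (fullv : {vspace g}).
set A := mxof b b f.
have [rs rsE] := closed_field_poly_normal (char_poly A).
apply/diagonalizablePeigen; exists (undup rs); first exact: undup_uniq.
set S := (\sum_(r <- _) _)%MS.
have rsP a : eigenvalue A a -> (eigenspace A a <= S)%MS.
  rewrite eigenvalue_root_char rsE rootZ ?lead_coef_eq0
    -?size_poly_eq0 ?size_char_poly //.
  rewrite root_prod_XsubC -mem_undup => ars.
  rewrite /S (big_nth 0) big_mkord.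
  have ar : (index a (undup rs) < size (undup rs))%N by rewrite index_mem.
  by rewrite (sumsmx_sup (Ordinal ar)) //= nth_index.
have SA : (S *m A <= S)%MS.
  rewrite /S; elim: (undup rs) => [ | r s IH]; first by rewrite big_nil mul0mx sub0mx.
  rewrite big_cons addsmxMr addsmxS //.
  by move/eigenspaceP: (submx_refl (eigenspace A r)) => ->; rewrite scalemx_sub.
have stableE (V : {vspace g}) : (f @: V <= V)%VS -> stablemx (msof b V) A.
  move=> fV; apply/rV_subP => _ /submxP[w ->].
  rewrite mulmxA -(vecofK bb (w *m _)) -rVof_app //.
  rewrite rVof_sub // msofK // (subvP fV) // memv_img //.
  by rewrite mem_vecof // submxMl.
have [] := fss (vsof b S).
  apply/subvP => _ /memv_imgP[u uS ->].
  rewrite -!rVof_sub // in uS *.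
  by rewrite (rVof_app b bb) (submx_trans (submxMr _ uS)).
move=> W [fW SWf SW0].
suff W0 : W = 0%VS.
  apply/eqmxP; rewrite submx1 /=; apply/rV_subP => v _.
  rewrite -[v](vecofK bb) rVof_sub //.
  by move: SWf; rewrite W0 addv0 => ->; rewrite memvf.
apply/eqP/contraT => Wn0.
have rW : (0 < \rank (msof b W))%N.
  by rewrite lt0n mxrank_eq0 msof_eq0.
(* An eigenvector of [A] restricted to [W] becomes one of [A] itself through [row_base]. *)
have [a] := eigenvalue_closed (restrictmx (msof b W) A) rW.
case/eigenvalueP => v /eqP; rewrite -(sameP eigenspaceP eqP).
have Ws := stableE _ fW.
rewrite sub_eigenspace_conjmx ?stablemx_row_base ?row_base_free // => vA v0.
set w := v *m row_base _ in vA.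
have w0 : w != 0 by rewrite mulmx_free_eq0 ?row_base_free.
have wS : vecof b w \in vsof b S.
  rewrite -rVof_sub // vecofK // (submx_trans vA) // rsP //.
  by apply/eigenvalueP; exists w => //; apply/eigenspaceP.
have wW : vecof b w \in W.
  rewrite mem_vecof // (submx_trans (submxMl _ _)) //.
  by rewrite eq_row_base.
have : vecof b w \in (vsof b S :&: W)%VS by rewrite memv_cap wS.
by rewrite SW0 memv0 vecof_eq0 // (negPf w0).
Qed.

Lemma cartan_weight_basis (C : numClosedFieldType) (g : lieAlgType C)
    (h : {vspace g}) :
  cartan_subalgebra h ->
  exists (e : (\dim {:g}).-tuple g) (lam : 'I_(\dim {:g}) -> 'Hom(subvs_of h, C^o)),
    basis_of fullv e /\
    forall (i : 'I_(\dim {:g})) (H : subvs_of h),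
      [| vsval H, e`_i |] = (lam i H : C) *: e`_i.
Proof.
case=> hab _ hss.
set b := vbasis (fullv : {vspace g}).
have bb : basis_of fullv b := vbasisP (fullv : {vspace g}).
pose As := [seq mxof b b (ad x) | x <- vbasis h].
have [P Pu /allP PA] : codiagonalizable As.
  apply/codiagonalizableP; split.
    move=> _ _ /mapP[x /vbasis_mem xh ->] /mapP[y /vbasis_mem yh ->].
    by rewrite /comm_mx -!(mxof_comp _ _ bb) ad_comm // hab.
  move=> _ /mapP[x /vbasis_mem xh ->].
  exact: semisimple_end_diagonalizable (hss _ xh).
pose e := [tuple vecof b (row i P) | i < \dim {:g}].
have eE (i : 'I_(\dim {:g})) : e`_i = vecof b (row i P).
  by rewrite -tnth_nth tnth_mktuple.
have eb : basis_of fullv e.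
  rewrite basisEfree subvf size_tuple leqnn !andbT.
  apply/freeP => k.
  have -> : \sum_i k i *: e`_i = vecof b ((\row_i k i) *m P).
    rewrite mulmx_sum_row linear_sum; apply: eq_bigr => i _.
    by rewrite linearZ /= eE mxE.
  move/eqP; rewrite vecof_eq0 // mulmx_free_eq0 ?row_free_unit // => /eqP k0 i.
  by have /rowP/(_ i) := k0; rewrite !mxE.
(* The [i]-th diagonal entry of [ad H]; writing [[H, e_i]] as [- ad e_i] applied to [H] makes it a
   composite of linear maps in [H]. *)
pose lam i : 'Hom(subvs_of h, C^o) :=
  (linfun (coord e i : g -> C^o) \o (- ad e`_i) \o linfun vsval)%VF.
have lamE i H : lam i H = coord e i [| vsval H, e`_i |].
  rewrite !comp_lfunE opp_lfunE adE -lieC.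
  rewrite [in LHS]lfunE /= [in LHS]lfunE /=.
  done.
exists e, lam; split => // i H; rewrite lamE.
have [k Hk] : exists k, [| vsval H, e`_i |] = k *: e`_i.
  rewrite (coord_vbasis (subvsP H)) lie_suml.
  have /all_sig [k kE] (j : 'I_(\dim h)) : {k | [| (vbasis h)`_j, e`_i |] = k *: e`_i}.
    apply: cid.
    set x := (vbasis h)`_j.
    have /PA : mxof b b (ad x) \in As by apply: map_f; rewrite mem_nth ?size_tuple.
    move=> /= /diagonalizable_forPex[D] /(simmxP Pu) /(congr1 (row i)).
    rewrite !row_mul row_diag_mx -scalemxAl -rowE mul_mxof => DE; exists (D 0 i).
    by rewrite eE -adE -[LHS](rVofK bb) DE linearZ.
  exists (\sum_j coord (vbasis h) j (vsval H) * k j).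
  rewrite scaler_suml; apply: eq_bigr => j _.
  by rewrite lieZl kE scalerA.
by rewrite Hk linearZ /= coord_free ?(basis_free eb) // eqxx mulr1.
Qed.

(** * The Killing form and its radical *)

Section Killing.
Context {K : fieldType} {g : lieAlgType K}.
Implicit Types (x y z : g) (u v : 'End(g)).

Lemma lfun_trace_is_scalar : scalar (@lfun_trace K g).
Proof. by move=> a u v; rewrite /lfun_trace linearP /= linearP. Qed.

HB.instance Definition _ := GRing.isSemilinear.Build K 'End(g) K *%R
  (@lfun_trace K g) (GRing.semilinear_linear lfun_trace_is_scalar).

Lemma ad_is_linear : linear (@ad K g).
Proof.
move=> a x y; apply/lfunP => z.
by rewrite add_lfunE scale_lfunE !adE lieDl lieZl.
Qed.

HB.instance Definition _ := GRing.isSemilinear.Build K g 'End(g) *:%R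
  (@ad K g) (GRing.semilinear_linear ad_is_linear).

Lemma killingC x y : killing x y = killing y x.
Proof. exact: lfun_traceC. Qed.

Lemma killing_is_scalar x : scalar (killing x).
Proof.
move=> a y z.
by rewrite /killing linearP comp_lfunDr -comp_lfunZr linearP.
Qed.

HB.instance Definition _ x := GRing.isSemilinear.Build K g K *%R
  (killing x) (GRing.semilinear_linear (killing_is_scalar x)).

Lemma ad_lie x y : ad [| x, y |] = ((ad x \o ad y) - (ad y \o ad x))%VF.
Proof.
apply/lfunP => z; rewrite add_lfunE opp_lfunE !comp_lfunE !adE [X in X - _]lie_jacobil.
by rewrite addrK.
Qed.

Lemma killing_lie x y z : killing [| x, y |] z = killing y [| z, x |].
Proof.
rewrite /killing !ad_lie comp_lfunDl comp_lfunNl comp_lfunDr comp_lfunNr.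
by rewrite !linearB /= -comp_lfunA lfun_traceC !comp_lfunA.
Qed.

Lemma killing_radical_ideal : exists2 I : {vspace g},
  lie_ideal I & forall x, x \in I <-> forall y, killing x y = 0.
Proof.
pose b := vbasis (fullv : {vspace g}).
(* The radical is the kernel of this map; invariance of the form makes it an ideal. *)
pose phi x : 'rV[K]_(\dim {:g}) := \row_j killing x b`_j.
have phiL : linear phi.
  by move=> a x y; apply/rowP => j; rewrite !mxE !(killingC _ b`_j) linearP.
pose phiM := GRing.isSemilinear.Build K _ _ _ phi (GRing.semilinear_linear phiL).
pose phi' : {linear g -> 'rV[K]_(\dim {:g})} := HB.pack phi phiM.
have inI x : x \in lker (linfun phi') <-> forall y, killing x y = 0.
  rewrite memv_ker lfunE /=; split => [/eqP/rowP x0 y | x0]; last first.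
    by apply/eqP/rowP => j; rewrite !mxE x0.
  rewrite (coord_vbasis (memvf y)) linear_sum big1 // => j _.
  by rewrite linearZ /=; have := x0 j; rewrite !mxE => ->; rewrite mulr0.
exists (lker (linfun phi')) => // x y /inI y0; apply/inI => z.
by rewrite killing_lie y0.
Qed.

End Killing.

(** The matrix of values of [S] on a basis of [V] has independent rows, so every row [v] lies in the
    row span of its transpose; the coefficients are the coordinates of [x]. *)
Lemma free_dual_eval (K : fieldType) (V : vectType K) (S : seq 'Hom(V, K^o))
    (v : 'I_(size S) -> K) :
  free S -> exists x : V, forall i : 'I_(size S), S`_i x = v i.
Proof.
move=> Sf; pose b := vbasis (fullv : {vspace V}).
pose M := \matrix_(i < size S, j < \dim {:V}) (S`_i b`_j : K).
have Mf : row_free M.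
  apply: inj_row_free => c cM0.
  have /freeP : free (in_tuple S) by [].
  move/(_ (fun i => c 0 i)) => c0; apply/rowP => i; rewrite mxE c0 //.
  apply/lfunP => x; rewrite zero_lfunE (coord_vbasis (memvf x)) linear_sum big1 // => j _.
  rewrite linearZ /= sum_lfunE; have /rowP/(_ j) := cM0; rewrite !mxE => c0j.
  under eq_bigr => k _ do rewrite scale_lfunE.
  under eq_bigr => k _ do rewrite /GRing.scale /=.
  move: c0j; rewrite (eq_bigr (fun k => c 0 k * S`_k b`_j)) => [-> | k _].
    by rewrite scaler0.
  by rewrite mxE.
have /submxP[u uE] : (\row_i v i <= M^T)%MS.
  by rewrite submx_full // /row_full mxrank_tr -/(row_free M).
exists (\sum_j u 0 j *: b`_j) => i.
have /rowP/(_ i) := uE; rewrite !mxE => ->.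
rewrite linear_sum; apply: eq_bigr => j _.
by rewrite !mxE linearZ.
Qed.

(** * Weights, roots and the Killing form in a weight basis *)

Section WeightBasis.
Context {K : fieldType} {g : lieAlgType K} {h : {vspace g}}.
Context {e : (\dim {:g}).-tuple g}.
Context {lam : 'I_(\dim {:g}) -> 'Hom(subvs_of h, K^o)}.
Hypothesis eb : basis_of fullv e.
Hypothesis lamE : forall (i : 'I_(\dim {:g})) (H : subvs_of h),
  [| vsval H, e`_i |] = (lam i H : K) *: e`_i.
Implicit Types (i j k l : 'I_(\dim {:g})) (H : subvs_of h).

Lemma basis_neq0 i : e`_i != 0.
Proof. by apply: (free_not0 (basis_free eb)); rewrite mem_nth ?size_tuple. Qed.

Lemma coord_lie_cartan i H (x : g) :
  coord e i [| vsval H, x |] = (lam i H : K) * coord e i x.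
Proof.
have fe := basis_free eb.
rewrite [in LHS](coord_basis eb (memvf x)) linear_sum /= linear_sum /=.
rewrite (bigD1 i) //= big1 => [ | j ji].
  by rewrite addr0 linearZ /= linearZ /= lamE linearZ /= coord_free // eqxx mulr1 mulrC.
rewrite linearZ /= linearZ /= lamE linearZ /= coord_free //.
by rewrite [_ == _](negPf ji) !mulr0.
Qed.

Lemma weight_lie i j l :
  coord e l [| e`_i, e`_j |] != 0 -> lam l = lam i + lam j.
Proof.
move=> c0; apply/lfunP => H; rewrite add_lfunE.
apply: (mulIf c0).
rewrite -coord_lie_cartan lie_jacobil !lamE lieZl !linearD /= !linearZ /=.
by rewrite mulrDl.
Qed.

(** [ad e_i] after [ad e_j] shifts weights by [lam i + lam j], so its diagonal entries vanish. *)
Lemma killing_weight i j : lam i + lam j != 0 -> killing e`_i e`_j = 0.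
Proof.
move=> ij0; rewrite /killing (lfun_traceE _ eb) big1 // => k _.
rewrite comp_lfunE !adE (coord_basis eb (memvf [| e`_j, e`_k |])) !linear_sum /=.
rewrite big1 // => l _; rewrite linearZ /= linearZ /=.
have [-> | /weight_lie ljk] := eqVneq (coord e l [| e`_j, e`_k |]) 0.
  by rewrite mul0r.
have [-> | /weight_lie kil] := eqVneq (coord e k [| e`_i, e`_l |]) 0.
  by rewrite mulr0.
move: ij0; rewrite -(inj_eq (addIr (lam k))) add0r -addrA -ljk -kil.
by rewrite eqxx.
Qed.

Lemma killing_cartan H :
  killing (vsval H) (vsval H) = \sum_i (lam i H : K) ^+ 2.
Proof.
rewrite /killing (lfun_traceE _ eb); apply: eq_bigr => i _.
rewrite comp_lfunE !adE coord_lie_cartan lamE linearZ /=.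
by rewrite coord_free ?(basis_free eb) // eqxx mulr1.
Qed.

Lemma root_weight alpha : is_root alpha -> exists i, alpha = lam i.
Proof.
case=> _ [x x0 xE]; have [i ci] : exists i, coord e i x != 0.
  apply/existsP; apply: contra_notT x0 => /existsPn c0.
  rewrite (coord_basis eb (memvf x)) big1 // => i _.
  by have /negPn/eqP -> := c0 i; rewrite scale0r.
exists i; apply/lfunP => H; apply: (mulIf ci).
by rewrite -coord_lie_cartan xE linearZ.
Qed.

Lemma weight_root i : lam i != 0 -> is_root (lam i).
Proof.
move=> li0; split; first exact/eqP.
by exists e`_i => [ | H]; [exact/eqP/basis_neq0 | exact: lamE].
Qed.

End WeightBasis.

(** * Symmetry of the root system *)

Lemma root_opp (C : numClosedFieldType) (g : lieAlgType C) (h : {vspace g})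
    (Sigma : seq 'Hom(subvs_of h, C^o)) (alpha : 'Hom(subvs_of h, C^o)) :
  simple_lie g -> cartan_subalgebra h -> simple_system Sigma ->
  is_root alpha -> is_root (- alpha).
Proof.
move=> [_ gs] hC [_ Sf Sr] ra.
have [e [lam [eb lamE]]] := cartan_weight_basis hC.
have [i aE] := root_weight eb lamE ra.
have [[j jE] | nj] := pselect (exists j, lam j = - alpha).
  rewrite -jE; apply: (weight_root eb lamE).
  by rewrite jE oppr_eq0; apply/eqP; case: ra.
have [I idI inI] := @killing_radical_ideal C g.
have eI : e`_i \in I.
  apply/inI => y; rewrite (coord_basis eb (memvf y)) linear_sum big1 // => j _.
  rewrite linearZ /= (killing_weight eb lamE) ?mulr0 //.
  apply/negP => /eqP ij0; apply: nj; exists j.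
  by apply/eqP; rewrite -addr_eq0 aE addrC ij0.
have If : I = fullv.
  case: (gs _ idI) => // I0.
  by move: eI; rewrite I0 memv0 (negPf (basis_neq0 eb i)).
have [H HS] := free_dual_eval (fun=> 1) Sf.
(* [N] is the height of [beta] up to sign. *)
have rootH beta : is_root beta -> exists N : nat,
    [/\ (beta H : C) = N%:R \/ (beta H : C) = - N%:R & N = 0%N -> beta = 0].
  move=> /Sr [c cE]; exists (\sum_(k < size Sigma) c k)%N; split.
    have sE : ((\sum_(k < size Sigma) Sigma`_k *+ c k) H : C)
              = (\sum_(k < size Sigma) c k)%:R.
      rewrite sum_lfunE natr_sum; apply: eq_bigr => k _.
      by rewrite -scaler_nat scale_lfunE HS [LHS]mulr1.
    by case: cE => ->; [left | right]; rewrite ?opp_lfunE sE.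
  move=> /eqP; rewrite sum_nat_eq0 => /forallP c0.
  have s0 : \sum_(k < size Sigma) Sigma`_k *+ c k = 0.
    by rewrite big1 // => k _; have /eqP -> := c0 k.
  by case: cE => ->; rewrite s0 ?oppr0.
have sq0 k : 0 <= (lam k H : C) ^+ 2.
  have [-> | lk] := eqVneq (lam k) 0; first by rewrite zero_lfunE expr0n.
  have [N [NE _]] := rootH _ (weight_root eb lamE lk).
  by case: NE => ->; rewrite ?sqrrN exprn_ge0.
have := killing_cartan eb lamE H.
have /inI -> : vsval H \in I by rewrite If memvf.
(* The squares are nonnegative with sum zero, so [alpha] vanishes at [H]; it then has height 0,
   which contradicts [alpha <> 0]. *)
move/esym/eqP; rewrite psumr_eq0 // => /allP/(_ i (mem_index_enum _)) /=.
rewrite -aE sqrf_eq0 => /eqP aH0.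
have [N [NE N0]] := rootH _ ra; case: ra => a0 _; case: a0; apply: N0.
move: NE; rewrite aH0 => -[] /eqP; rewrite eq_sym ?oppr_eq0 pnatr_eq0 => /eqP //.
Qed.

Local Open Scope classical_set_scope.

(** * Chains of zero sum triples in a symmetric set *)

Section ZeroSumTriples.
Context {V : zmodType} (G : set V).
Hypothesis GN : forall x, G x -> G (- x).

Definition tzs_equiv (a b : V) := [\/ b = a, b = - a | tzs_linked G a b].

Lemma tzs_equivN a b : tzs_equiv a b -> tzs_equiv a (- b).
Proof.
case=> [-> | -> | [n [T [GT Ta Tb TT]]]]; first exact: Or32.
  by apply: Or31; rewrite opprK.
by apply: Or33; exists n, T; split=> //; rewrite opprK orC.
Qed.

(** A chain from [a] ends in a triple containing [x] or [-x]; it is prolonged by the given triple in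
    the first case and by its negative in the second. If [x] is [a] or [-a], the triple alone is a
    chain. *)
Lemma tzs_linked_triple a x y z :
  G x -> G y -> G z -> x + y + z = 0 -> tzs_equiv a x -> tzs_linked G a y.
Proof.
move=> Gx Gy Gz xyz0 ax.
have triple : zero_sum_triple G [set x; y; z] by exists x, y, z.
have tripleN : zero_sum_triple G [set - x; - y; - z].
  exists (- x), (- y), (- z); split; rewrite ?GN //; try exact: GN.
  by rewrite -!opprD xyz0 oppr0.
have linked0 : x = a \/ x = - a -> tzs_linked G a y.
  move=> xa; exists 0%N, (fun=> [set x; y; z]); split=> //.
    by case: xa => <-; [left | right]; left; left.
  by left; left; right.
case: ax => [xa | xa | [n [T [GT Ta Tx TT]]]];
  [by apply: linked0; left | by apply: linked0; right | ].
have extend (W : set V) : zero_sum_triple G W -> W y \/ W (- y) ->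
    T n `&` W !=set0 -> tzs_linked G a y.
  move=> GW Wy TW; exists n.+1, (fun p => if (p <= n)%N then T p else W).
  split=> [p _ | | | p]; rewrite ?ltnn ?leq0n //.
    by case: ifP => // /GT.
  rewrite ltnS => pn; rewrite pn; have [/TT // | np] := ltnP p n.
  by have -> : p = n by apply/eqP; rewrite eqn_leq pn.
case: Tx => Tx.
  by apply: (extend _ triple); [left; left; right | exists x; split=> //; left; left].
by apply: (extend _ tripleN); [right; left; right | exists (- x); split=> //; left; left].
Qed.

(** Both parts use the triple [x, y, -(x + y)], listed in different orders. *)
Lemma tzs_equivD a x y :
  G x -> G y -> G (x + y) -> tzs_equiv a x ->
  tzs_equiv a y /\ tzs_equiv a (x + y).
Proof.
move=> Gx Gy Gxy ax; split.
  by apply/Or33/(tzs_linked_triple Gx Gy (GN Gxy)); rewrite ?subrr.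
rewrite -[x + y]opprK; apply/tzs_equivN/Or33.
apply: (tzs_linked_triple Gx (GN Gxy) Gy) => //.
by rewrite addrAC subrr.
Qed.

(* If 0 is a t-root, the triples [a, 0, -a] connect everything; this covers the case
   in which [t] is too small to separate [R_M] from 0. *)
Lemma tzs_connected_zero : G 0 -> tzs_connected G.
Proof.
move=> G0 a b Ga Gb _ _.
have a0 : tzs_linked G a 0.
  by apply: (tzs_linked_triple Ga G0 (GN Ga)); rewrite ?addr0 ?subrr //; exact: Or31.
by apply: (tzs_linked_triple G0 Gb (GN Gb)); rewrite ?add0r ?subrr //; exact: Or33.
Qed.

End ZeroSumTriples.

(** * Gradings of a simple Lie algebra *)

(** The hypotheses make [G] exactly the set of nonzero degrees [w i] of a grading. The degrees live
    in an arbitrary additive group because t-roots are plain functions on [t_space]. *)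
Lemma tzs_connected_grading (K : fieldType) (g : lieAlgType K)
    (e : (\dim {:g}).-tuple g) (V : zmodType) (w : 'I_(\dim {:g}) -> V)
    (G : set V) :
  simple_lie g -> basis_of fullv e ->
  (forall i j l : 'I_(\dim {:g}),
     coord e l [| e`_i, e`_j |] != 0 -> w l = w i + w j) ->
  (forall x, G x -> G (- x)) -> ~ G 0 ->
  (forall i, w i = 0 \/ G (w i)) -> (forall x, G x -> exists i, x = w i) ->
  tzs_connected G.
Proof.
move=> [_ gs] eb wL GN nG0 wG Gw a b Ga Gb ba baN; apply: contrapT => nab.
pose C := tzs_equiv G a.
have bC : ~ C b by case=> // [/esym // | bN]; apply: baN; rewrite bN opprK.
pose q x := G x /\ ~ C x.
pose Q i := `[< q (w i) >].
have QP i : Q i <-> q (w i) by split=> /asboolP.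
have nq i : ~~ Q i -> w i = 0 \/ G (w i) /\ C (w i).
  move=> /negP; rewrite QP => nqi; have [-> | Gi] := wG i; first by left.
  by right; split=> //; apply: contrapT => nC; apply: nqi.
have sumP k i l : w l = w k + w i -> w k <> 0 -> w i <> 0 -> C (w k) -> C (w i).
  move=> wl wk0 wi0 Ck.
  have [// | Gk] := wG k; have [// | Gi] := wG i.
  have [l0 | Gl] := wG l.
    have -> : w i = - w k by apply/eqP; rewrite -addr_eq0 addrC -wl l0.
    exact: tzs_equivN.
  by rewrite wl in Gl; have [] := tzs_equivD GN Gk Gi Gl Ck.
have q_closed i j l : ~~ Q i -> ~~ Q j -> w l = w i + w j -> ~~ Q l.
  move=> nQi nQj wl; apply/negP; rewrite QP => -[Gl nCl].
  have [i0 | [Gi Ci]] := nq _ nQi.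
    by move/negP: nQj; rewrite QP; apply; rewrite /q -[w j]add0r -i0 -wl.
  have [j0 | [Gj _]] := nq _ nQj.
    by apply: nCl; rewrite wl j0 addr0.
  by apply: nCl; rewrite wl in Gl *; have [] := tzs_equivD GN Gi Gj Gl Ci.
have CQ i j l : C (w i) -> w i <> 0 -> Q j -> w l <> w j + w i.
  move=> Ci wi0 /QP[Gj nCj] wl; apply: nCj; apply: (sumP i j l) => //.
    by rewrite addrC.
  by move=> j0; apply: nG0; rewrite -j0.
(* By [CQ], only [w i = 0] can occur here. *)
have q_ideal i j l : ~~ Q i -> Q j -> w l = w j + w i -> Q l.
  move=> /nq[i0 | [Gi Ci]] Qj wl; first by apply/QP; rewrite wl i0 addr0; apply/QP.
  by case: (CQ i j l) => // i0; apply: nG0; rewrite -i0.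
pose J := (\bigcap_(j | Q j)
  (lker (linfun (coord e j : g -> K^o)) :&: lker (ad e`_j)))%VS.
have JP x : x \in J <-> forall j, Q j -> coord e j x = 0 /\ [| e`_j, x |] = 0.
  split=> [xJ j Qj | H].
    have : x \in (lker (linfun (coord e j : g -> K^o)) :&: lker (ad e`_j))%VS.
      by apply: subvP xJ; rewrite /J (bigcapv_inf j).
    by rewrite memv_cap !memv_ker adE lfunE => /andP[/eqP ? /eqP ?].
  rewrite memvE; apply/subv_bigcapP => j /H[x0 y0]; rewrite -memvE.
  by rewrite memv_cap !memv_ker adE lfunE /= x0 y0 !eqxx.
have idJ : lie_ideal J.
  move=> x y yJ; rewrite (coord_basis eb (memvf x)) lie_suml memv_suml // => k _.
  rewrite lieZl memvZ //.
  have /JP yP := yJ.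
  have [/yP[_ ->] | nQk] := boolP (Q k); first exact: mem0v.
  apply/JP => j Qj; split.
    rewrite (coord_basis eb (memvf y)) !linear_sum big1 // => i _; rewrite !linearZ /=.
    have [Qi | nQi] := boolP (Q i); first by have [-> _] := yP i Qi; rewrite mul0r.
    have [-> | /wL wj] := eqVneq (coord e j [| e`_k, e`_i |]) 0; first by rewrite mulr0.
    by move: (q_closed _ _ _ nQk nQi wj); rewrite Qj.
  (* What remains is [[[e_j, e_k], y]]; by [q_ideal], [[e_j, e_k]] has components in [Q] only, and
     these commute with [y]. *)
  rewrite lie_jacobil; have [_ ->] := yP j Qj; rewrite linear0 addr0.
  rewrite (coord_basis eb (memvf [| e`_j, e`_k |])) lie_suml big1 // => l _.
  rewrite lieZl.
  have [-> | /wL wl] := eqVneq (coord e l [| e`_j, e`_k |]) 0; first by rewrite scale0r.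
  by have [_ ->] := yP l (q_ideal _ _ _ nQk Qj wl); rewrite scaler0.
have fe := basis_free eb.
have [i ai] := Gw a Ga; have [j bj] := Gw b Gb.
have Ci : C (w i) by rewrite -ai; exact: Or31.
have wi0 : w i <> 0 by move=> i0; apply: nG0; rewrite -i0 -ai.
have eJ : e`_i \in J.
  apply/JP => k Qk; split.
    rewrite coord_free // [_ == _](_ : _ = false) //.
    by apply/eqP => ik; move/QP: Qk => -[_]; rewrite -ik.
  rewrite (coord_basis eb (memvf [| e`_k, e`_i |])) big1 // => l _.
  have [-> | /wL wl] := eqVneq (coord e l [| e`_k, e`_i |]) 0; first by rewrite scale0r.
  by have := CQ i k l Ci wi0 Qk.
(* [J] contains [e_i], so it is all of [g]; but [e_j], of degree [b], has [j]-th coordinate 1 where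
   membership in [J] requires 0. *)
have [J0 | Jf] := gs J idJ.
  by move: eJ; rewrite J0 memv0 (negPf (basis_neq0 eb i)).
have Qj : Q j by apply/QP; rewrite -bj.
have /JP/(_ j Qj)[/eqP] : e`_j \in J by rewrite Jf memvf.
by rewrite coord_free // eqxx oner_eq0.
Qed.

(** * The grading by t-roots *)

Theorem theorem4p1 (R : realType) (g : lieAlgType R[i]) (h : {vspace g})
    (Sigma Theta : seq 'Hom(subvs_of h, R[i]^o)) :
  simple_lie g ->
  cartan_subalgebra h ->
  simple_system Sigma ->
  {subset Theta <= Sigma} ->
  tzs_connected (t_roots Theta).
Proof.
move=> sg hC hS _.
have [e [lam [eb lamE]]] := cartan_weight_basis hC.
have GN x : t_roots Theta x -> t_roots Theta (- x).
  move=> [al [ra nal] <-]; exists (- al).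
    split; first exact: root_opp sg hC hS ra.
    by move=> [_ alT]; apply: nal; split=> //; rewrite -memvN.
  by apply/funext => H; rewrite /t_restr opp_lfunE.
have [G0 | nG0] := pselect (t_roots Theta 0); first exact: tzs_connected_zero.
apply: (@tzs_connected_grading _ g e _ (fun i => t_restr Theta (lam i))) => //.
- move=> i j l /(weight_lie eb lamE) ->.
  by apply/funext => H; rewrite /t_restr add_lfunE.
- move=> i; have [-> | li0] := eqVneq (lam i) 0.
    by left; apply/funext => H; rewrite /t_restr zero_lfunE.
  have ri := weight_root eb lamE li0.
  (* Roots in the span of [Theta] vanish on [t] by its definition and get degree 0; all others
     restrict to t-roots. *)
  have [Ti | nTi] := boolP (lam i \in <<Theta>>%VS).
    left; apply/funext => H; rewrite /t_restr.
    by have [_ ->] := set_mem (valP H).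
  by right; exists (lam i) => //; split=> // -[_]; exact/negP.
- move=> _ [al [ra _] <-].
  by have [i ->] := root_weight eb lamE ra; exists i.
Qed.
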